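(* Let $d\ge 2$ and let a separable sampling scheme on $\mathbb{S}^d$ be given: $Q_0,\dots,Q_{d-1}\in\mathbb{N}$, $N=\prod_{j=0}^{d-1}Q_j$; for each $j=1,\dots,d$ positive real weights $w^{(j)}_{k_{j-1}}$, $k_{j-1}=0,\dots,Q_{j-1}-1$, with $\sum_{k_{j-1}=0}^{Q_{j-1}-1}w^{(j)}_{k_{j-1}}=1$; angles $\vartheta^{(j)}_{k_{j-1}}\in[0,\pi]$ ($1\le j\le d-1$, $0\le k_{j-1}\le Q_{j-1}-1$) and $\varphi_{k_{d-1}}\in[0,2\pi]$ ($0\le k_{d-1}\le Q_{d-1}-1$). The $N$ sampling points are $(\vartheta^{(1)}_{k_0},\dots,\vartheta^{(d-1)}_{k_{d-2}},\varphi_{k_{d-1}})$, and the point with indices $(k_0,\dots,k_{d-1})$ has weight $\prod_{j=1}^{d}w^{(j)}_{k_{j-1}}$. Then for all $\ell,\ell'\ge 0$, $\mathbf{m}\in\mathcal{M}_\ell$, $\mathbf{m}'\in\mathcal{M}_{\ell'}$ (with $m_0=\ell$, $m_0'=\ell'$), the aliasing function of this scheme satisfies $$\tau(\ell,\mathbf{m};\ell',\mathbf{m}')=\frac{1}{2\pi}\left(\prod_{j=1}^{d-1}h_{m_{j-1},m_j;j}\,h_{m'_{j-1},m'_j;j}\;I^{Q_{j-1}}_{m_{j-1},m_j}(m'_{j-1},m'_j)\right)J^{Q_{d-1}}_{m_{d-1}}(m'_{d-1}),$$ where $$J^{Q_{d-1}}_{m_{d-1}}(m'_{d-1})=\sum_{k_{d-1}=0}^{Q_{d-1}-1}w^{(d)}_{k_{d-1}}e^{i(m'_{d-1}-m_{d-1})\varphi_{k_{d-1}}},$$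 $$I^{Q_{j-1}}_{m_{j-1},m_j}(m'_{j-1},m'_j)=\sum_{k_{j-1}=0}^{Q_{j-1}-1}w^{(j)}_{k_{j-1}}\left(\sin\vartheta^{(j)}_{k_{j-1}}\right)^{m_j+m'_j+d-j}C^{\left(m_j+\frac{d-j}{2}\right)}_{m_{j-1}-m_j}\!\left(\cos\vartheta^{(j)}_{k_{j-1}}\right)C^{\left(m'_j+\frac{d-j}{2}\right)}_{m'_{j-1}-m'_j}\!\left(\cos\vartheta^{(j)}_{k_{j-1}}\right).$$
   Context: Points of $\mathbb{S}^d$ are written in spherical coordinates $x=(\boldsymbol\vartheta,\varphi)=(\vartheta^{(1)},\dots,\vartheta^{(d-1)},\varphi)$, $\vartheta^{(i)}\in[0,\pi]$, $\varphi\in[0,2\pi)$. Put $f(\boldsymbol\vartheta)=\prod_{j=1}^{d-1}(\sin\vartheta^{(j)})^{d-j}$. For $\ell\ge0$, $\mathcal{M}_\ell$ is the set of $\mathbf{m}=(m_1,\dots,m_{d-1})\in\mathbb{Z}^{d-1}$ with $\ell\ge m_1\ge\dots\ge m_{d-2}\ge0$ and $-m_{d-2}\le m_{d-1}\le m_{d-2}$; convention $m_0=\ell$. $C^{(\alpha)}_n$ is the Gegenbauer polynomial of degree $n$ and parameter $\alpha$ (generating function $(1-2tz+z^2)^{-\alpha}=\sum_n C_n^{(\alpha)}(t)z^n$). The hyperspherical harmonics are $$Y_{\ell,\mathbf{m}}(x)=\frac{1}{\sqrt{2\pi}}\prod_{j=1}^{d-1}\left(h_{m_{j-1},m_j;j}\,C^{\left(m_j+\frac{d-j}{2}\right)}_{m_{j-1}-m_j}(\cos\vartheta^{(j)})(\sin\vartheta^{(j)})^{m_j}\right)e^{im_{d-1}\varphi},$$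 $$h_{m_{j-1},m_j;j}=\left(\frac{2^{2m_j+d-j-2}(m_{j-1}-m_j)!\,(2m_{j-1}+d-j)\,\Gamma^2\!\left(m_j+\frac{d-j}{2}\right)}{\pi\,(m_{j-1}+m_j+d-j-1)!}\right)^{1/2}$$ (expressions with a negative power of $\sin$ at a pole are understood by continuity). Given sampling points $x_i=(\boldsymbol\vartheta_i,\varphi_i)$ with weights $w_i$, $i=1,\dots,N$, the aliasing function is $$\tau(\ell,\mathbf{m};\ell',\mathbf{m}')=\sum_{i=1}^{N}w_i\,Y_{\ell',\mathbf{m}'}(\boldsymbol\vartheta_i,\varphi_i)\,\overline{Y_{\ell,\mathbf{m}}(\boldsymbol\vartheta_i,\varphi_i)}\,f(\boldsymbol\vartheta_i).$$ *)

(* Defs.v *)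
From HB Require Import structures.
From mathcomp Require Import all_boot all_order all_algebra.
From mathcomp Require Import all_classical all_reals all_analysis.
From mathcomp Require Import complex.

Set Implicit Arguments.
Unset Strict Implicit.
Unset Printing Implicit Defensive.
Import Order.TTheory GRing.Theory Num.Theory.
Import numFieldNormedType.Exports.
Local Open Scope classical_set_scope.
Local Open Scope ring_scope.
Local Open Scope complex_scope.

(* Throughout, j is 1-based, 1 <= j <= d - 1, while the colatitudes
   (vartheta^(1), ..., vartheta^(d-1)) of a point of S^d form a function th on
   'I_d.-1, so that th i is vartheta^(i+1). *)

(* The Euler-Gauss limit, which gives Gamma at every real x that is not a pole;
   arguments here may be negative half-integers. *)
Definition Gamma (R : realType) (x : R) : R :=
  lim ((n`!%:R * n%:R `^ x / \prod_(0 <= k < n.+1) (x + k%:R)) @[n --> \oo]).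

(* C_n^(a)(t) is the coefficient of z^n in the Taylor expansion at z = 0 of the
   generating function (1 - 2 t z + z^2)^(-a), for any real a. *)
Definition gegenbauer (R : realType) (a : R) (n : nat) (t : R) : R :=
  derive1n n (fun z : R => (1 - 2 * t * z + z ^+ 2) `^ (- a)) 0 / n`!%:R.

(* (sin x)^p * c(x), extended by continuity to the poles sin x = 0 when the
   exponent p is negative. *)
Definition sin_pow_mul (R : realType) (p : int) (c : R -> R) (x : R) : R :=
  if (p < 0) && (sin x == 0) then lim ((sin y ^ p * c y) @[y --> x^'])
  else sin x ^ p * c x.

Definition cis (R : realType) (x : R) : R[i] := cos x +i* sin x.

(* m_j for 0 <= j <= d - 1, with the convention m_0 = l *)
Definition mth (d l : nat) (m : (d.-1).-tuple int) (j : nat) : int :=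
  nth 0 (l%:Z :: m) j.

Definition multi_index (d l : nat) (m : (d.-1).-tuple int) : Prop :=
  [/\ forall j : nat, (1 <= j <= d - 2)%N -> mth l m j <= mth l m j.-1,
      0 <= mth l m (d - 2)
    & - mth l m (d - 2) <= mth l m (d - 1) <= mth l m (d - 2)].

(* the parameter m_j + (d - j) / 2, where b = m_j *)
Definition gparam (R : realType) (d j : nat) (b : int) : R :=
  b%:~R + (d - j)%:R / 2.

(* h_{a,b;j}; the integers under the absolute values are nonnegative when
   a = m_{j-1} and b = m_j with multi_index l m *)
Definition hcoef (R : realType) (d j : nat) (a b : int) : R :=
  Num.sqrt
    (2 ^ (2 * b + d%:Z - j%:Z - 2) * (absz (a - b)%R)`!%:R
       * (2 * a + d%:Z - j%:Z)%:~R * Gamma (gparam R d j b) ^+ 2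
     / (pi * (absz (a + b + d%:Z - j%:Z - 1)%R)`!%:R)).

(* C^(b + (d-j)/2)_{a-b}(cos x), with a = m_{j-1} and b = m_j *)
Definition gegen_cos (R : realType) (d j : nat) (a b : int) (x : R) : R :=
  gegenbauer (gparam R d j b) (absz (a - b)%R) (cos x).

Definition sph_harmonic (R : realType) (d l : nat) (m : (d.-1).-tuple int)
    (th : 'I_d.-1 -> R) (ph : R) : R[i] :=
  ((Num.sqrt (2 * pi))^-1 *
     \prod_(i < d.-1)
        (hcoef R d i.+1 (mth l m i) (mth l m i.+1) *
         sin_pow_mul (mth l m i.+1)
           (gegen_cos d i.+1 (mth l m i) (mth l m i.+1)) (th i)))%:C
  * cis ((mth l m (d - 1))%:~R * ph).

Definition density (R : realType) (d : nat) (th : 'I_d.-1 -> R) : R :=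
  \prod_(i < d.-1) sin (th i) ^+ (d - i.+1).

(* The aliasing function of sampling points (th p, ph p) with weights wt p,
   indexed by the elements p of a finite type. *)
Definition aliasing (R : realType) (d : nat) (T : finType) (wt : T -> R)
    (th : T -> 'I_d.-1 -> R) (ph : T -> R)
    (l : nat) (m : (d.-1).-tuple int) (l' : nat) (m' : (d.-1).-tuple int)
    : R[i] :=
  \sum_(p : T) (wt p)%:C * sph_harmonic l' m' (th p) (ph p)
    * (sph_harmonic l m (th p) (ph p))^*%C * (density (th p))%:C.

(* Indices ((k_0, ..., k_{d-2}), k_{d-1}), with 0 <= k_j < Q_j, of the points
   of a separable scheme on S^d. *)
Definition grid (d : nat) (Q : nat -> nat) : finType :=
  ({dffun forall i : 'I_d.-1, 'I_(Q i)} * 'I_(Q d.-1))%type.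

Lemma card_grid (d : nat) (Q : nat -> nat) :
  (0 < d)%N -> #|grid d Q| = (\prod_(j < d) Q j)%N.
Proof.
case: d => // d _; rewrite card_prod card_ord card_dep_ffun big_ord_recr /=.
by rewrite foldrE big_map big_enum; under eq_bigr do rewrite card_ord.
Qed.

(* Families are indexed as w^(j)_k and vartheta^(j)_k, with j 1-based and
   k 0-based. *)
Definition grid_weight (R : realType) (d : nat) (Q : nat -> nat)
    (w : nat -> nat -> R) (k : grid d Q) : R :=
  (\prod_(i < d.-1) w i.+1 (k.1 i)) * w d k.2.

Definition grid_theta (R : realType) (d : nat) (Q : nat -> nat)
    (theta : nat -> nat -> R) (k : grid d Q) : 'I_d.-1 -> R :=
  fun i => theta i.+1 (k.1 i).

Definition grid_phi (R : realType) (d : nat) (Q : nat -> nat)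
    (phi : nat -> R) (k : grid d Q) : R := phi k.2.

(* J^q_m(m') for weights w_0, ..., w_{q-1} and angles phi_0, ..., phi_{q-1} *)
Definition Jsum (R : realType) (q : nat) (w phi : nat -> R) (m m' : int)
    : R[i] :=
  \sum_(0 <= k < q) (w k)%:C * cis ((m' - m)%:~R * phi k).

(* I^q_{a,b}(a',b') at coordinate j, with a = m_{j-1}, b = m_j, a' = m'_{j-1},
   b' = m'_j *)
Definition Isum (R : realType) (d j q : nat) (w theta : nat -> R)
    (a b a' b' : int) : R :=
  \sum_(0 <= k < q) w k *
    sin_pow_mul (b + b' + d%:Z - j%:Z)
      (fun x => gegen_cos d j a b x * gegen_cos d j a' b' x) (theta k).

(* Main.v *)
(* Off the poles the summand of tau factors over the coordinates, and the sum over
   the grid of a product is the product of the sums. At a pole sin vartheta^(j) = 0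
   the density makes the left-hand summand vanish, so the matching term of
   I^Q, possibly a limit with a negative power of sin, has to vanish too. This
   matters only for j = d - 1 and m_{d-1} = -n < 0, where it follows from
   (1 - t^2)^n dividing C^(1/2-n)_k(t) for k >= 2n. To prove the divisibility, the
   three-term recurrence decouples at k = 2n + 1, so that all these C_k are
   multiples of C_{2n}, and
   (1 - 2tz + z^2)^(s+1) = (1 - 2tz + z^2) (1 - 2tz + z^2)^s shows that C_{2n}
   equals, up to a constant, 1 - t^2 times its analogue for n - 1. *)

Require Import Defs.
From HB Require Import structures.
From mathcomp Require Import all_boot all_order all_algebra.
From mathcomp Require Import all_classical all_reals all_analysis.
From mathcomp Require Import complex ring lra zify.

Set Implicit Arguments.
Unset Strict Implicit.
Unset Printing Implicit Defensive.
Import Order.TTheory GRing.Theory Num.Theory.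
Import numFieldNormedType.Exports.
Local Open Scope ring_scope.
Local Open Scope complex_scope.

(** * Sequences of successive derivatives near 0 *)

(** Only germs at 0 are constrained, because the real powers of 1 - 2tz + z^2 are differentiated
    only where this base is positive. *)
Definition jet {R : realType} (F : nat -> R -> R) : Prop :=
  forall k, \forall z \near (0 : R), is_derive z (1 : R) (F k) (F k.+1 z).

Section Jets.
Context {R : realType}.
Implicit Types (F G : nat -> R -> R) (q : {poly R}).

(** A derivative depends only on nearby values, so an identity near 0 may be differentiated any
    number of times. *)
Lemma jet_unique F G : jet F -> jet G ->
  (\forall z \near (0 : R), F 0%N z = G 0%N z) ->
  forall k, \forall z \near (0 : R), F k z = G k z.
Proof.
move=> jF jG FG0; elim=> [//|k /near_join FGk].
near=> z.
have dF : is_derive z (1 : R) (F k) (F k.+1 z) by near: z; exact: jF.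
have dG : is_derive z (1 : R) (G k) (G k.+1 z) by near: z; exact: jG.
have FGz : \forall y \near z, F k y = G k y by near: z.
by rewrite -(derive_val (is_derive := dF)) -(derive_val (is_derive := dG));
   apply: near_eq_derive.
Unshelve. all: by end_near. Qed.

Lemma jet_derive1n F : jet F ->
  forall k, \forall z \near (0 : R), derive1n k (F 0%N) z = F k z.
Proof.
move=> jF; elim=> [|k /near_join IH]; first by near=> z; rewrite derive1n0.
near=> z; rewrite derive1nS derive1E.
have dF : is_derive z (1 : R) (F k) (F k.+1 z) by near: z; exact: jF.
rewrite -(derive_val (is_derive := dF)).
by apply: near_eq_derive; near: z.
Unshelve. all: by end_near. Qed.

Lemma jet_shift F : jet F -> jet (fun k => F k.+1).
Proof. by move=> jF k; exact: jF. Qed.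

Lemma jetZ c F : jet F -> jet (fun k z => c * F k z).
Proof.
move=> jF k; near=> z.
have dF : is_derive z (1 : R) (F k) (F k.+1 z) by near: z; exact: jF.
exact: is_deriveZ.
Unshelve. all: by end_near. Qed.

(** Leibniz's rule for q F, cut after q'' since q has degree at most 2. Where a predecessor of k
    truncates, its coefficient is 0. *)
Lemma jetM q F : (size q <= 3)%N -> jet F ->
  jet (fun k z => q.[z] * F k z + k%:R * q^`().[z] * F k.-1 z
                  + 'C(k, 2)%:R * q^`()^`().[z] * F k.-2 z).
Proof.
move=> sq jF k.
have q3 : q^`()^`()^`() = 0.
  by have := derivn_poly0 sq; rewrite !derivnS derivn0.
(* Pascal's rule for the Leibniz coefficients; j = 0 and j = 1 are separate because of the truncated
   predecessors. *)
have pascal j z :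
    q.[z] * F j.+1 z + F j z * q^`().[z]
    + (j%:R * q^`().[z] * F j.-1.+1 z + F j.-1 z * (j%:R * q^`()^`().[z]))
    + ('C(j, 2)%:R * q^`()^`().[z] * F j.-2.+1 z
       + F j.-2 z * ('C(j, 2)%:R * 0)) =
    q.[z] * F j.+1 z + j.+1%:R * q^`().[z] * F j z
    + 'C(j.+1, 2)%:R * q^`()^`().[z] * F j.-1 z.
  case: j => [|[|j]] /=.
  - by rewrite !bin_small //; ring.
  - by rewrite binn bin_small //; ring.
  - by rewrite [in RHS]binS bin1 natrD; ring.
near=> z.
have d0 : is_derive z (1 : R) (F k) (F k.+1 z) by near: z; exact: jF.
have d1 : is_derive z (1 : R) (F k.-1) (F k.-1.+1 z) by near: z; exact: jF.
have d2 : is_derive z (1 : R) (F k.-2) (F k.-2.+1 z) by near: z; exact: jF.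
by apply: is_derive_eq; rewrite q3 horner0; exact: pascal.
Unshelve. all: by end_near. Qed.

End Jets.

(** * Derivatives of a real power of a polynomial *)

Section PowerJet.
Context {R : realType}.
Variables (g : {poly R}) (s : R).

(** The k-th derivative of g^s is a polynomial times g^(s-k); differentiating that product gives
    this recursion. *)
Fixpoint pow_numer (k : nat) : {poly R} :=
  if k is j.+1 then
    (pow_numer j)^`() * g + (s - j%:R) *: (g^`() * pow_numer j)
  else 1.

Definition pow_jet (k : nat) (z : R) : R :=
  (pow_numer k).[z] * g.[z] `^ (s - k%:R).

Lemma pow_jet0 z : pow_jet 0 z = g.[z] `^ s.
Proof. by rewrite /pow_jet subr0 hornerE mul1r. Qed.

Lemma jet_pow_jet : (\forall z \near (0 : R), 0 < g.[z]) -> jet pow_jet.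
Proof.
move=> g_gt0 k; near=> z.
have gz : 0 < g.[z] by near: z.
have dg := is_derive1_comp (is_derive1_powR (s - k%:R) gz) (is_derive_poly g z).
have := is_deriveM (is_derive_poly (pow_numer k) z) dg.
move=> /is_derive_eq; apply.
rewrite /pow_jet /= /GRing.scale /= !(hornerD, hornerM, hornerZ).
(* Both terms of the product rule are brought to the common power g^(s-k-1). *)
have -> : g.[z] `^ (s - k%:R) = g.[z] * g.[z] `^ (s - k%:R - 1).
  rewrite -{2}[g.[z]]powRr1 ?ltW // -powRD ?(gt_eqF gz) ?implybT //.
  by congr (_ `^ _); ring.
have -> : s - k.+1%:R = s - k%:R - 1 by rewrite -natr1; ring.
by ring.
Unshelve. all: by end_near. Qed.

End PowerJet.

Lemma bin2R (R : pzRingType) k : 'C(k, 2)%:R * 2 = (k * k.-1)%:R :> R.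
Proof. by rewrite -natrM -[2%N]/(2`!) bin_ffact ffactnS ffactn1. Qed.

(** * Gegenbauer recurrences for an arbitrary real parameter *)

Section GeneratingFunction.
Context {R : realType}.
Variable t : R.

Definition gen_base : {poly R} := 1 - (2 * t) *: 'X + 'X^2.

Lemma horner_gen_base z : gen_base.[z] = 1 - 2 * t * z + z ^+ 2.
Proof. by rewrite !hornerE. Qed.

Lemma deriv_gen_base : gen_base^`() = 2 *: 'X - (2 * t)%:P.
Proof.
apply/polyP => i; rewrite /gen_base coef_deriv !coefE.
by case: i => [|[|i]] /=; rewrite ?mulr0n; ring.
Qed.

Lemma deriv2_gen_base : gen_base^`()^`() = 2%:P.
Proof. by rewrite deriv_gen_base derivB derivZ derivX derivC subr0 alg_polyC. Qed.

Lemma size_gen_base : (size gen_base <= 3)%N.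
Proof.
apply/leq_sizeP => i hi; rewrite /gen_base !coefE.
by case: i hi => [|[|[|i]]] //=; rewrite mulr0 subr0 addr0.
Qed.

Lemma gen_base_at0 : gen_base.[0] = 1.
Proof. by rewrite horner_gen_base; ring. Qed.

Lemma gen_base_gt0 : \forall z \near (0 : R), 0 < gen_base.[z].
Proof.
have h : (gen_base.[z] @[z --> (0 : R)] --> gen_base.[0])%classic.
  exact: continuous_horner.
by apply: (cvgr_gt _ h); rewrite gen_base_at0.
Qed.

Lemma deriv_gen_base_at0 : gen_base^`().[0] = - (2 * t).
Proof. by rewrite deriv_gen_base hornerD hornerN hornerZ hornerX hornerC; ring. Qed.

Definition gen_jet (s : R) : nat -> R -> R := pow_jet gen_base s.

Lemma jet_gen_jet s : jet (gen_jet s).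
Proof. by apply: jet_pow_jet; exact: gen_base_gt0. Qed.

Lemma gegenbauer_jet a k : gegenbauer a k t = gen_jet (- a) k 0 / k`!%:R.
Proof.
rewrite /gegenbauer -(nbhs_singleton (jet_derive1n (jet_gen_jet (- a)) k)).
congr (_ / _); congr (derive1n k _ 0); apply/funext => z.
by rewrite [RHS]pow_jet0 horner_gen_base.
Qed.

(* The k-th derivative at 0 of g F' = s g' F, where F = g^s. *)
Lemma gen_jet_ode s k :
  gen_jet s k.+1 0 - 2 * t * k%:R * gen_jet s k 0
  + (k * k.-1)%:R * gen_jet s k.-1 0 =
  s * (2 * k%:R * gen_jet s k.-1 0 - 2 * t * gen_jet s k 0).
Proof.
have jF := @jet_gen_jet s.
have sz' : (size gen_base^`()%R <= 3)%N.
  rewrite deriv_gen_base; apply/leq_sizeP => i hi; rewrite !coefE.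
  by case: i hi => [|[|[|i]]] //=; rewrite mulr0 subr0.
have J1 := jetM size_gen_base (jet_shift jF).
have J2 := jetZ s (jetM sz' jF).
have E : \forall z \near (0 : R),
    gen_base.[z] * gen_jet s 1 z + 0%:R * gen_base^`().[z] * gen_jet s 1 z
     + 'C(0, 2)%:R * gen_base^`()^`().[z] * gen_jet s 1 z =
    s * (gen_base^`().[z] * gen_jet s 0 z
     + 0%:R * gen_base^`()^`().[z] * gen_jet s 0 z
     + 'C(0, 2)%:R * gen_base^`()^`()^`().[z] * gen_jet s 0 z).
  near=> z.
  have gz : 0 < gen_base.[z] by near: z; exact: gen_base_gt0.
  rewrite (_ : 'C(0, 2) = 0%N) // !mul0r !addr0 /gen_jet pow_jet0 /pow_jet /=.
  rewrite derivC mul0r add0r mulr1 hornerZ subr0 -{1}[gen_base.[z]]powRr1 ?ltW //.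
  have -> : gen_base.[z] `^ s = gen_base.[z] `^ 1 * gen_base.[z] `^ (s - 1).
    by rewrite -powRD ?(gt_eqF gz) ?implybT //; congr (_ `^ _); ring.
  by ring.
have /nbhs_singleton := jet_unique J1 J2 E k.
rewrite gen_base_at0 deriv_gen_base_at0 deriv2_gen_base derivC horner0 hornerC.
have -> : k%:R * - (2 * t) * gen_jet s k.-1.+1 0
          = k%:R * - (2 * t) * gen_jet s k 0 by case: k => [|k]; rewrite ?mul0r.
have -> : 'C(k, 2)%:R * 2 * gen_jet s k.-2.+1 0
          = 'C(k, 2)%:R * 2 * gen_jet s k.-1 0 by case: k => [|[|k]]; rewrite ?mul0r.
by rewrite bin2R => JE; lra.
Unshelve. all: by end_near. Qed.

(** Leibniz's rule at 0 for g^(s+1) = g g^s. *)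
Lemma gen_jetS s k :
  gen_jet (s + 1) k 0 = gen_jet s k 0 - 2 * t * k%:R * gen_jet s k.-1 0
                        + (k * k.-1)%:R * gen_jet s k.-2 0.
Proof.
have J := jetM size_gen_base (@jet_gen_jet s).
have E : \forall z \near (0 : R),
    gen_jet (s + 1) 0 z =
    gen_base.[z] * gen_jet s 0 z + 0%:R * gen_base^`().[z] * gen_jet s 0 z
     + 'C(0, 2)%:R * gen_base^`()^`().[z] * gen_jet s 0 z.
  near=> z.
  have gz : 0 < gen_base.[z] by near: z; exact: gen_base_gt0.
  rewrite (_ : 'C(0, 2) = 0%N) // !mul0r !addr0 /gen_jet !pow_jet0.
  by rewrite powRD ?(gt_eqF gz) ?implybT // powRr1 ?ltW // mulrC.
have /nbhs_singleton := jet_unique (@jet_gen_jet (s + 1)) J E k.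
rewrite gen_base_at0 deriv_gen_base_at0 deriv2_gen_base hornerC => ->.
by rewrite -bin2R; ring.
Unshelve. all: by end_near. Qed.

Lemma gegenbauer0 a : gegenbauer a 0 t = 1.
Proof.
rewrite gegenbauer_jet divr1 [LHS]pow_jet0 gen_base_at0.
by rewrite powR1.
Qed.

Lemma gegenbauer1 a : gegenbauer a 1 t = 2 * a * t.
Proof.
rewrite gegenbauer_jet divr1; have := gen_jet_ode (- a) 0.
have := gegenbauer0 a; rewrite gegenbauer_jet divr1 /= => ->.
lra.
Qed.

(** This is [gen_jet_ode] at order k + 1 with s = -a, divided by (k+1)!. *)
Lemma gegenbauer_rec a k :
  k.+2%:R * gegenbauer a k.+2 t =
  2 * t * (k.+1%:R + a) * gegenbauer a k.+1 t
  - (k%:R + 2 * a) * gegenbauer a k t.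
Proof.
rewrite !gegenbauer_jet; have := gen_jet_ode (- a) k.+1 => /= ode.
have k2 : k.+2%:R != 0 :> R by rewrite pnatr_eq0.
have k1 : k.+1%:R != 0 :> R by rewrite pnatr_eq0.
have kf : k`!%:R != 0 :> R by rewrite pnatr_eq0 -lt0n fact_gt0.
rewrite !factS !natrM.
have -> : gen_jet (- a) k.+2 0 =
  2 * t * k.+1%:R * gen_jet (- a) k.+1 0 - (k.+1 * k)%:R * gen_jet (- a) k 0
  - a * (2 * k.+1%:R * gen_jet (- a) k 0 - 2 * t * gen_jet (- a) k.+1 0).
  lra.
rewrite natrM; field.
by rewrite kf nat1r k1 -natrD k2.
Qed.

(** Taylor coefficients in g^(-a) = g g^(-(a+1)). *)
Lemma gegenbauer_param a k :
  gegenbauer a k.+2 t =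
  gegenbauer (a + 1) k.+2 t - 2 * t * gegenbauer (a + 1) k.+1 t
  + gegenbauer (a + 1) k t.
Proof.
rewrite !gegenbauer_jet; have := gen_jetS (- (a + 1)) k.+2 => /=.
rewrite [- (a + 1) + 1](_ : _ = - a); last by ring.
move=> ->.
have k2 : k.+2%:R != 0 :> R by rewrite pnatr_eq0.
have k1 : k.+1%:R != 0 :> R by rewrite pnatr_eq0.
have kf : k`!%:R != 0 :> R by rewrite pnatr_eq0 -lt0n fact_gt0.
rewrite !factS !natrM; field.
by rewrite kf nat1r k1 -natrD k2.
Qed.

End GeneratingFunction.

(** * Divisibility by (1 - t^2)^n at parameter 1/2 - n *)

Section HalfIntegerParameter.
Context {R : realType}.
Implicit Types (a t : R) (n k : nat).

Lemma gegenbauer_poly a k :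
  exists p : {poly R}, forall t, gegenbauer a k t = p.[t].
Proof.
(* The recurrence has order two, so the induction carries two consecutive degrees. *)
suff [//] : (exists p : {poly R}, forall t, gegenbauer a k t = p.[t]) /\
            (exists p : {poly R}, forall t, gegenbauer a k.+1 t = p.[t]).
elim: k => [|k [[p0 IH0] [p1 IH1]]]; split.
- by exists 1 => t; rewrite gegenbauer0 hornerC.
- by exists ((2 * a) *: 'X) => t; rewrite gegenbauer1 hornerZ hornerX.
- by exists p1.
exists (k.+2%:R^-1 *: ((2 * (k.+1%:R + a)) *: ('X * p1) - (k%:R + 2 * a) *: p0)) => t.
rewrite hornerZ hornerD hornerN !hornerZ hornerM hornerX -IH0 -IH1.
apply: (@mulfI _ k.+2%:R); first by rewrite pnatr_eq0.
rewrite gegenbauer_rec mulVKf ?pnatr_eq0 //; ring.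
Qed.

(* At k = 2n + 1 the coefficient of C_{k-2} in the three-term recurrence
   vanishes. *)
Lemma gegenbauer_half_odd n t :
  gegenbauer (1 / 2 - n%:R) n.*2.+1 t = t * gegenbauer (1 / 2 - n%:R) n.*2 t.
Proof.
case: n => [|n]; first by rewrite gegenbauer1 gegenbauer0; field.
apply: (@mulfI _ n.+1.*2.+1%:R); first by rewrite pnatr_eq0.
rewrite doubleS gegenbauer_rec.
have -> : n.*2.+1%:R + 2 * (1 / 2 - n.+1%:R) = 0 :> R.
  by rewrite -muln2 -!natr1 natrM; field.
by rewrite mul0r subr0 -!natr1 -muln2 natrM; field.
Qed.

(** Once [gegenbauer_param] has moved the parameter to 1/2 - n, the recurrence and
    [gegenbauer_half_odd] reduce every term to C_{2n}. *)
Lemma gegenbauer_half_even n t :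
  n.*2.+2%:R * gegenbauer (1 / 2 - n.+1%:R) n.+1.*2 t =
  n.*2.+1%:R * (1 - t ^+ 2) * gegenbauer (1 / 2 - n%:R) n.*2 t.
Proof.
rewrite doubleS gegenbauer_param.
have -> : 1 / 2 - n.+1%:R + 1 = 1 / 2 - n%:R :> R by rewrite -natr1; ring.
rewrite !mulrDr mulrN gegenbauer_rec gegenbauer_half_odd.
by rewrite -!natr1 -muln2 natrM; field.
Qed.

Lemma gegenbauer_half_factor n k :
  exists p : {poly R}, forall t,
    gegenbauer (1 / 2 - n%:R) (n.*2 + k) t = (1 - t ^+ 2) ^+ n * p.[t].
Proof.
suff [//] : (exists p : {poly R}, forall t,
    gegenbauer (1 / 2 - n%:R) (n.*2 + k) t = (1 - t ^+ 2) ^+ n * p.[t]) /\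
  (exists p : {poly R}, forall t,
    gegenbauer (1 / 2 - n%:R) (n.*2 + k).+1 t = (1 - t ^+ 2) ^+ n * p.[t]).
elim: k => [|k [[p0 IH0] [p1 IH1]]].
  rewrite addn0.
  (* Both base cases follow from C_{2n} = c (1 - t^2)^n, as C_{2n+1} = t C_{2n}. *)
  suff [c E] : exists c : R, forall t,
      gegenbauer (1 / 2 - n%:R) n.*2 t = c * (1 - t ^+ 2) ^+ n.
    split; first by exists c%:P => t; rewrite E hornerC mulrC.
    exists (c *: 'X) => t.
    by rewrite gegenbauer_half_odd E hornerZ hornerX; ring.
  elim: n => [|n [c IH]]; first by exists 1 => t; rewrite gegenbauer0 mulr1.
  exists (n.*2.+2%:R^-1 * n.*2.+1%:R * c) => t.
  apply: (@mulfI _ n.*2.+2%:R); first by rewrite pnatr_eq0.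
  by rewrite gegenbauer_half_even IH (exprS _ n) -!mulrA mulVKf ?pnatr_eq0 //; ring.
rewrite !addnS; split; first by exists p1.
set N := (n.*2 + k)%N in IH0 IH1 *; set a := 1 / 2 - n%:R in IH0 IH1 *.
exists (N.+2%:R^-1 *: ((2 * (N.+1%:R + a)) *: ('X * p1) - (N%:R + 2 * a) *: p0)) => t.
rewrite hornerZ hornerD hornerN !hornerZ hornerM hornerX.
apply: (@mulfI _ N.+2%:R); first by rewrite pnatr_eq0.
rewrite gegenbauer_rec IH0 IH1 [RHS]mulrCA mulVKf ?pnatr_eq0 //; ring.
Qed.

End HalfIntegerParameter.

(** * Vanishing at the poles *)

Section Poles.
Context {R : realType}.

(* What multi_index guarantees for a = m_{j-1} and b = m_j: only m_{d-1} can be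
   negative. *)
Definition nonneg_or_last (d j : nat) (a b : int) : bool :=
  (0 <= b) || ((d - j == 1)%N && (- b <= a)).

(** The exponent is 0 for b >= 0. For b = -n < 0 it is 2n: the parameter is 1/2 - n, the degree is
    2n + (a + b) with a + b >= 0, and 1 - cos^2 = sin^2. *)
Lemma gegen_cos_factor (d j : nat) (a b : int) : nonneg_or_last d j a b ->
  exists2 G : R -> R, continuous G &
    forall x, gegen_cos d j a b x = sin x ^ (`|b| - b) * G x.
Proof.
have ccos (p : {poly R}) : continuous (fun x : R => p.[cos x]).
  by move=> x; apply: continuous_comp; [exact: continuous_cos|exact: continuous_horner].
rewrite /nonneg_or_last /gegen_cos /gparam; have [b0 _|b0 /andP[/eqP-> ba]] := leP 0 b.
  have [p E] := gegenbauer_poly (b%:~R + (d - j)%:R / 2 : R) (absz (a - b)).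
  exists (fun x => p.[cos x]) => // x.
  by rewrite E ger0_norm // subrr expr0z mul1r.
have bE : b = - (absz b)%:Z by lia.
have -> : absz (a - b) = ((absz b).*2 + absz (a + b)%R)%N by lia.
have -> : b%:~R + 1 / 2 = 1 / 2 - (absz b)%:R :> R.
  by rewrite {1}bE mulrNz -pmulrn addrC.
have [p E] := @gegenbauer_half_factor R (absz b) (absz (a + b)).
exists (fun x => p.[cos x]) => // x.
rewrite E; congr (_ * _).
have -> : `|b| - b = ((absz b).*2)%:Z by lia.
by rewrite -sin2cos2 -exprM mul2n.
Qed.

(** With the sines hidden in the Gegenbauer factors, the total exponent p + r is |b| + |b'| + d - j
    > 0, and the remaining factor is continuous. *)
Lemma sin_pow_mul_eq0 (d j : nat) (a b a' b' : int) (x : R) : (j < d)%N ->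
  nonneg_or_last d j a b -> nonneg_or_last d j a' b' -> sin x = 0 ->
  sin_pow_mul (b + b' + d%:Z - j%:Z)
    (fun x => gegen_cos d j a b x * gegen_cos d j a' b' x) x = 0.
Proof.
move=> jd /gegen_cos_factor[G cG GE] /gegen_cos_factor[G' cG' GE'] sx.
set p := b + b' + d%:Z - j%:Z.
set r := `|b| - b + (`|b'| - b').
have pr : 0 < p + r by rewrite /p /r; lia.
have cE y : gegen_cos d j a b y * gegen_cos d j a' b' y = sin y ^ r * (G y * G' y).
  (* Exponents add only over a nonzero base; at sin y = 0 a power is 1 or 0 according to whether its
     exponent is 0, and both exponents are nonnegative. *)
  have [s0|s0] := eqVneq (sin y) 0; last first.
    by rewrite GE GE' (expfzDr (`|b| - b) (`|b'| - b') s0) mulrACA.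
  rewrite GE GE' s0 !exp0rz.
  have -> : (r == 0) = (`|b| - b == 0) && (`|b'| - b' == 0) by rewrite /r; lia.
  by case: eqP; case: eqP => _ _ /=; ring.
rewrite /sin_pow_mul sx eqxx andbT; case: ltP => p0; last first.
  rewrite cE sx mulrA !exp0rz.
  have [p00|_] := eqVneq p 0; last by rewrite !mul0r.
  (* For p = 0 the zero comes from the Gegenbauer factors, since then r > 0. *)
  by rewrite (_ : (r == 0) = false) ?mulr0 ?mul0r //; lia.
apply: cvg_lim; first exact: Rhausdorff.
have -> : (fun y => sin y ^ p * (gegen_cos d j a b y * gegen_cos d j a' b' y))
    = (fun y => sin y ^ (p + r) * (G y * G' y)).
  apply/funext => y; rewrite cE mulrA; congr (_ * _).
  have [s0|s0] := eqVneq (sin y) 0; last by rewrite (expfzDr p r s0).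
  (* 0 ^ p = 0 for p < 0 as well, since 0^-1 = 0 *)
  by rewrite s0 !exp0rz (lt_eqF p0) (gt_eqF pr) !mul0r.
have [q prE q0] : exists2 q : nat, p + r = q%:Z & (0 < q)%N.
  by exists (absz (p + r)%R); lia.
rewrite prE.
(* The limit becomes the value at x of a continuous function. *)
rewrite (_ : 0 = sin x ^+ q * (G x * G' x)); last first.
  by rewrite sx expr0n gtn_eqF // mul0r.
apply/continuous_withinNx.
have c1 : {for x, continuous (fun y : R => sin y ^+ q)}.
  apply: (@continuous_comp _ _ _ (@sin R) (fun z : R => z ^+ q)).
    exact: continuous_sin.
  exact: (@exprn_continuous R q).
exact: (cvgM c1 (cvgM (cG x) (cG' x))).
Qed.

End Poles.

(** * Separation of the sum over the grid *)

(** The ranges [T i] vary with i; they are embedded in one type of tagged pairs, where ordinary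
    distributivity applies. *)
Lemma sum_dffun_prod (R : comPzSemiRingType) (I : finType) (T : I -> finType)
    (F : forall i, T i -> R) :
  \sum_(k : {dffun forall i, T i}) \prod_i F i (k i) = \prod_i \sum_(x : T i) F i x.
Proof.
rewrite (reindex (@dffun_of_fprod I T)); last exact/onW_bij/dffun_of_fprod_bij.
under eq_bigr do under eq_bigr do rewrite ffunE.
under [RHS]eq_bigr do rewrite big_tag.
rewrite bigA_distr_big_dep.
have big_fprodF := @big_fprod R 0 1 *%R +%R I T (fun i => [ffun x => F i x]).
transitivity (\sum_t \prod_(i in I) [ffun x => F i x] (fun_of_fprod t i)).
  by apply: eq_bigr => t _; apply: eq_bigr => i _; rewrite ffunE.
rewrite big_fprodF; apply: eq_bigr => g _; apply: eq_bigr => i _.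
by rewrite /untag; case: eqP => // e; rewrite ffunE.
Qed.

Lemma cisD {R : realType} (x y : R) : cis (x + y) = cis x * cis y.
Proof. by rewrite /cis sinD cosD; simpc; congr (_ +i* _); ring. Qed.

Lemma conjcM_cis {R : realType} (u x : R) :
  (u%:C * cis x)^*%C = u%:C * cis (- x).
Proof. by rewrite /cis sinN cosN; simpc. Qed.

(** Off the poles the exponents add. At a pole the density factor, with d - j > 0, kills the left
    side and [sin_pow_mul_eq0] the right. *)
Lemma sin_pow_mulM {R : realType} (d j : nat) (a b a' b' : int) (x : R) :
  (j < d)%N -> nonneg_or_last d j a b -> nonneg_or_last d j a' b' ->
  sin_pow_mul b (gegen_cos d j a b) x * sin_pow_mul b' (gegen_cos d j a' b') x
    * sin x ^+ (d - j) =
  sin_pow_mul (b + b' + d%:Z - j%:Z)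
    (fun x => gegen_cos d j a b x * gegen_cos d j a' b' x) x.
Proof.
move=> jd ab ab'; have [s0|s0] := eqVneq (sin x) 0.
  rewrite sin_pow_mul_eq0 // s0 expr0n (_ : (d - j == 0)%N = false) ?mulr0 //.
  lia.
rewrite /sin_pow_mul (negPf s0) !andbF -addrA subzn ?(ltnW jd) // !expfzDr //.
by rewrite -exprnP; ring.
Qed.

Lemma multi_index_nonneg_or_last (d l : nat) (m : (d.-1).-tuple int) (i : nat) :
  (2 <= d)%N -> multi_index l m -> (i < d.-1)%N ->
  nonneg_or_last d i.+1 (mth l m i) (mth l m i.+1).
Proof.
move=> d2 [mono m0 bnd] id1.
have [id2|id2] := leqP i.+1 (d - 2); last first.
  have -> : i = (d - 2)%N by lia.
  rewrite /nonneg_or_last (_ : (d - 2).+1 = (d - 1)%N); last by lia.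
  by apply/orP; right; case/andP: bnd; lia.
apply/orP; left; apply: le_trans m0 _.
(* The decreasing chain carries m_{d-2} >= 0 back to every earlier index. *)
suff H k : (i.+1 + k <= d - 2)%N -> mth l m (i.+1 + k) <= mth l m i.+1.
  by have := H (d - 2 - i.+1)%N; rewrite subnKC //; apply.
elim: k => [|k IH] hk; first by rewrite addn0.
apply: le_trans (IH _); last by lia.
by have := mono (i.+1 + k.+1)%N; rewrite addnS /=; apply; lia.
Qed.

Theorem theorem1 (R : realType) (d : nat) (hd : (2 <= d)%N)
  (Q : nat -> nat) (w theta : nat -> nat -> R) (phi : nat -> R)
  (w_gt0 : forall j k : nat, (1 <= j <= d)%N -> (k < Q j.-1)%N -> 0 < w j k)
  (w_sum1 : forall j : nat, (1 <= j <= d)%N ->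
     \sum_(0 <= k < Q j.-1) w j k = 1)
  (theta_range : forall j k : nat, (1 <= j <= d - 1)%N -> (k < Q j.-1)%N ->
     0 <= theta j k <= pi)
  (phi_range : forall k : nat, (k < Q d.-1)%N -> 0 <= phi k <= 2 * pi)
  (l l' : nat) (m m' : (d.-1).-tuple int)
  (hm : multi_index l m) (hm' : multi_index l' m') :
  aliasing (@grid_weight R d Q w) (@grid_theta R d Q theta)
    (@grid_phi R d Q phi) l m l' m' =
  ((2 * pi)^-1 *
   \prod_(1 <= j < d)
     (hcoef R d j (mth l m j.-1) (mth l m j) *
      hcoef R d j (mth l' m' j.-1) (mth l' m' j) *
      Isum d j (Q j.-1) (w j) (theta j)
        (mth l m j.-1) (mth l m j) (mth l' m' j.-1) (mth l' m' j)))%:C *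
  Jsum (Q d.-1) (w d) phi (mth l m (d - 1)) (mth l' m' (d - 1)).
Proof.
pose H (i : 'I_d.-1) : R := hcoef R d i.+1 (mth l m i) (mth l m i.+1)
  * hcoef R d i.+1 (mth l' m' i) (mth l' m' i.+1).
pose A (i : 'I_d.-1) (k : 'I_(Q i)) : R := H i * (w i.+1 k *
  sin_pow_mul (mth l m i.+1 + mth l' m' i.+1 + d%:Z - i.+1%:Z)
    (fun x => gegen_cos d i.+1 (mth l m i) (mth l m i.+1) x
              * gegen_cos d i.+1 (mth l' m' i) (mth l' m' i.+1) x)
    (theta i.+1 k)).
pose B (k : 'I_(Q d.-1)) : R[i] :=
  (w d k)%:C * cis ((mth l' m' (d - 1) - mth l m (d - 1))%:~R * phi k).
(* The contribution of one grid point is a product of factors each depending on a single index. *)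
have node (k : grid d Q) :
  (grid_weight w k)%:C * sph_harmonic l' m' (grid_theta theta k) (grid_phi phi k)
    * (sph_harmonic l m (grid_theta theta k) (grid_phi phi k))^*%C
    * (density (grid_theta theta k))%:C =
  ((2 * pi)^-1 * \prod_i A i (k.1 i))%:C * B k.2.
  (* All real factors are gathered under one embedding, and the two phases add. *)
  have collect (a b u v x y : R) :
      a%:C * (u%:C * cis x) * (v%:C * cis y) * b%:C
      = (a * u * v * b)%:C * cis (x + y).
    by rewrite cisD !rmorphM /=; ring.
  rewrite /sph_harmonic conjcM_cis collect /B mulrA -rmorphM /=.
  congr (_%:C * cis _); last by rewrite rmorphB mulrBl.
  have -> : (2 * pi)^-1 = (Num.sqrt (2 * pi))^-1 ^+ 2 :> R.
    by rewrite exprVn sqr_sqrtr // mulr_ge0 // pi_ge0.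
  set S := (Num.sqrt _)^-1; rewrite /grid_weight /density.
  set W := \prod_(i < d.-1) w _ _; set P' := \prod_(i < d.-1) _.
  set P := \prod_(i < d.-1) _; set D := \prod_(i < d.-1) _.
  suff -> : \prod_i A i (k.1 i) = W * P' * P * D by ring.
  rewrite -!big_split /=; apply: eq_bigr => i _; rewrite /A -sin_pow_mulM.
  - by rewrite /H /grid_theta; ring.
  - by have := ltn_ord i; lia.
  - exact: multi_index_nonneg_or_last.
  - exact: multi_index_nonneg_or_last.
rewrite /aliasing (eq_bigr _ (fun k _ => node k)).
(* The longitude sum splits off first; the colatitude sum then factors by [sum_dffun_prod]. *)
rewrite -(pair_bigA _ (fun (k1 : {dffun forall i : 'I_d.-1, 'I_(Q i)})
    (k2 : 'I_(Q d.-1)) => ((2 * pi)^-1 * \prod_i A i (k1 i))%:C * B k2)) /=.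
rewrite -big_distrlr /= -rmorph_sum /= -big_distrr /= sum_dffun_prod.
congr (((_ * _)%:C) * _); last by rewrite /Jsum big_mkord.
rewrite big_add1 big_mkord; apply: eq_bigr => i _.
by rewrite /A -big_distrr /= /Isum big_mkord.
Qed.
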